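(* Let $A$ be a real nonsingular $n\times n$ matrix, let $b\in\mathbb{R}^n$ with $b\neq 0$, and let $A=\tilde A+UV^T$, where $\tilde A$ is a nonsingular $n\times n$ matrix, $U=(u_1,\ldots,u_s)\in\mathbb{R}^{n\times s}$ has nonzero columns, and $V=(e_{j_1},e_{j_2},\ldots,e_{j_s})\in\mathbb{R}^{n\times s}$ with distinct indices $j_1,\ldots,j_s$. Let $\varepsilon>0$. Let $\hat y\in\mathbb{R}^n$ be an approximate solution of $\tilde A y=b$ and let $\hat w_j\in\mathbb{R}^n$ be an approximate solution of $\tilde A w_j=u_j$, $j=1,\ldots,s$. Define $\hat W=(\hat w_1,\ldots,\hat w_s)$ and the residuals $r_{\hat y}=b-\tilde A\hat y$ and $r_{\hat w_j}=u_j-\tilde A\hat w_j$. Assume that $I+V^T\hat W$ is nonsingular, define $$c=\|(I+V^T\hat W)^{-1}(V^T\hat y)\|,$$ assume $c\neq 0$, and take $$\hat x=\hat y-\hat W(I+V^T\hat W)^{-1}(V^T\hat y)$$ as an approximate solution of $Ax=b$. If $$\frac{\|r_{\hat y}\|}{\|b\|}<\frac{\varepsilon}{2}$$ and $$\frac{\|r_{\hat w_j}\|}{\|u_j\|}<\frac{\|b\|}{2\sqrt{s}\,c\,\|u_j\|}\,\varepsilon,\qquad j=1,2,\ldots,s,$$ then, with $r=b-A\hat x$, $$\frac{\|r\|}{\|b\|}=\frac{\|b-A\hat x\|}{\|b\|}<\varepsilon.$$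
   Context: $\|\cdot\|$ denotes the vector 2-norm (and the matrix spectral norm), and $e_j$ is the $j$-th column of the $n\times n$ identity matrix. In $I+V^T\hat W$, $I$ is the $s\times s$ identity. In the paper the splitting arises as follows: $j_1,\ldots,j_s$ are the indices of the irregular (relatively dense) columns of $A$, $\tilde A$ is obtained from $A$ by setting some of the nonzero entries in these columns to zero, and $u_i$ is the vector of dropped entries of column $j_i$, i.e. the difference between column $j_i$ of $A$ and column $j_i$ of $\tilde A$; hence $A=\tilde A+UV^T$. An ''approximate solution'' is just a given vector; its accuracy is measured only through the residuals in the hypotheses. *)

(* Defs.v *)
From mathcomp Require Export all_boot all_order all_algebra.
From mathcomp Require Export reals.
Export Order.TTheory GRing.Theory Num.Theory.

Set Implicit Arguments.
Unset Strict Implicit.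
Unset Printing Implicit Defensive.

Local Open Scope ring_scope.

(* The Euclidean norm; the norm that MathComp-Analysis puts on matrices is the
   maximum norm, hence this separate definition. *)
Definition norm2 (R : realType) (n : nat) (v : 'cV[R]_n) : R :=
  Num.sqrt (\sum_(i < n) v i 0 ^+ 2).

(* The n x s matrix (v_1, ..., v_s) with the given columns. *)
Definition mx_of_cols (R : realType) (n s : nat) (v : 'I_s -> 'cV[R]_n) :
    'M[R]_(n, s) :=
  \matrix_(i < n, k < s) v k i 0.

(* Main.v *)
Require Import Defs.
From mathcomp Require Import ring lra.

(** Set [M := 1 + V^T W] and [z := M^-1 (V^T y)], so that [x = y - W z].  The
    vector [z] is exactly what [V^T] sees of the approximate solution: from
    [M z = V^T y] one gets [V^T x = V^T y - V^T W z = z].  Hence the update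
    [U V^T] acts on [x] as [U V^T x = U z], and the residual splits into
    the residuals of the two kinds of auxiliary systems
    ([residual_low_rank_update]):

      [b - A x = (b - Atilde y) - (U - Atilde W) z].

    The first term has norm below [(eps / 2) |b|] by assumption.  The second is
    the combination of the column residuals [u_k - Atilde w_k] with
    coefficients [z_k]; each of them has norm at most [|b| eps / (2 sqrt s c)],
    and [\sum_k |z_k| <= sqrt s * c] by Cauchy-Schwarz, so the second term has
    norm at most [(eps / 2) |b|] ([norm2_mulmx_cols_le]).  The strict bound on
    the first term makes the sum strict. *)

Set Implicit Arguments.
Unset Strict Implicit.
Unset Printing Implicit Defensive.

Local Open Scope ring_scope.

(** The defect is Lagrange's sum of squares:
    [2 (|a|^2 |b|^2 - <a, b>^2) = \sum_(i, j) (a_i b_j - a_j b_i)^2]. *)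
Lemma cauchy_schwarz_sum (R : realDomainType) (I : finType) (a b : I -> R) :
  (\sum_i a i * b i) ^+ 2 <= (\sum_i a i ^+ 2) * (\sum_i b i ^+ 2).
Proof.
have lagrange : \sum_i \sum_j (a i * b j - a j * b i) ^+ 2 =
    2 * ((\sum_i a i ^+ 2) * (\sum_i b i ^+ 2) - (\sum_i a i * b i) ^+ 2).
  transitivity (\sum_i \sum_j (a i ^+ 2 * b j ^+ 2 + b i ^+ 2 * a j ^+ 2
                               - 2 * ((a i * b i) * (a j * b j)))).
    by apply: eq_bigr => i _; apply: eq_bigr => j _; ring.
  under eq_bigr => i _ do
    rewrite sumrB big_split /= -!mulr_sumr.
  rewrite sumrB big_split /= -!mulr_sumr -!mulr_suml.
  by ring.
have : 0 <= \sum_i \sum_j (a i * b j - a j * b i) ^+ 2.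
  by apply: sumr_ge0 => i _; apply: sumr_ge0 => j _; exact: sqr_ge0.
by rewrite lagrange pmulr_rge0 // subr_ge0.
Qed.

Section Norm2.
Variable R : realType.

Lemma norm2_ge0 n (v : 'cV[R]_n) : 0 <= norm2 v.
Proof. exact: sqrtr_ge0. Qed.

Lemma sqr_norm2 n (v : 'cV[R]_n) : norm2 v ^+ 2 = \sum_i v i 0 ^+ 2.
Proof. by rewrite sqr_sqrtr // sumr_ge0 // => i _; exact: sqr_ge0. Qed.

Lemma norm2_gt0 n (v : 'cV[R]_n) : v != 0 -> 0 < norm2 v.
Proof.
move=> v_neq0; rewrite lt0r norm2_ge0 andbT; apply: contra v_neq0.
rewrite -sqrf_eq0 sqr_norm2 psumr_eq0 => [/allP v0|i _]; last exact: sqr_ge0.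
apply/eqP/colP => i; rewrite mxE; apply/eqP; rewrite -sqrf_eq0.
by apply: v0; rewrite mem_index_enum.
Qed.

Lemma norm20 n : norm2 (0 : 'cV[R]_n) = 0.
Proof.
by rewrite /norm2 big1 ?sqrtr0 // => i _; rewrite mxE expr0n.
Qed.

Lemma norm2Z n (a : R) (v : 'cV[R]_n) : norm2 (a *: v) = `|a| * norm2 v.
Proof.
rewrite /norm2; under eq_bigr => i _ do rewrite mxE exprMn.
by rewrite -mulr_sumr sqrtrM ?sqr_ge0 // sqrtr_sqr.
Qed.

Lemma norm2N n (v : 'cV[R]_n) : norm2 (- v) = norm2 v.
Proof. by rewrite -scaleN1r norm2Z normrN1 mul1r. Qed.

Lemma dot_le_norm2 n (v w : 'cV[R]_n) :
  \sum_i v i 0 * w i 0 <= norm2 v * norm2 w.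
Proof.
apply: le_trans (ler_norm _) _.
rewrite -ler_sqr ?nnegrE ?mulr_ge0 ?norm2_ge0 ?normr_ge0 //.
by rewrite real_normK ?num_real // exprMn !sqr_norm2 cauchy_schwarz_sum.
Qed.

Lemma ler_norm2D n (v w : 'cV[R]_n) : norm2 (v + w) <= norm2 v + norm2 w.
Proof.
rewrite -ler_sqr ?nnegrE ?addr_ge0 ?norm2_ge0 //.
have -> : norm2 (v + w) ^+ 2 =
    norm2 v ^+ 2 + norm2 w ^+ 2 + 2 * \sum_i v i 0 * w i 0.
  rewrite !sqr_norm2 mulr_sumr -!big_split /=.
  by apply: eq_bigr => i _; rewrite mxE; ring.
have := dot_le_norm2 v w; lra.
Qed.

Lemma ler_norm2_sum n (I : finType) (v : I -> 'cV[R]_n) :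
  norm2 (\sum_k v k) <= \sum_k norm2 (v k).
Proof.
elim/big_rec2: _ => [|k x y _ le_yx]; first by rewrite norm20.
by apply: le_trans (ler_norm2D _ _) _; rewrite lerD2l.
Qed.

(** Cauchy-Schwarz against the all-ones vector, whose norm is [sqrt s]. *)
Lemma sum_norm_le_norm2 s (z : 'cV[R]_s) :
  \sum_k `|z k 0| <= Num.sqrt s%:R * norm2 z.
Proof.
rewrite -ler_sqr ?nnegrE ?mulr_ge0 ?sqrtr_ge0 ?sumr_ge0 //.
rewrite exprMn sqr_sqrtr ?ler0n // sqr_norm2.
have := cauchy_schwarz_sum (fun=> 1) (fun k => `|z k 0|).
under eq_bigr => k _ do rewrite mul1r.
under [X in _ <= X * _ -> _]eq_bigr => k _ do rewrite expr1n.
rewrite sumr_const card_ord.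
by under [X in _ <= _ * X -> _]eq_bigr => k _ do
  rewrite real_normK ?num_real //.
Qed.

End Norm2.

Lemma mulmx_cols (R : realType) n s (v : 'I_s -> 'cV[R]_n) (z : 'cV[R]_s) :
  mx_of_cols v *m z = \sum_k z k 0 *: v k.
Proof.
apply/colP => i; rewrite mxE summxE.
by apply: eq_bigr => k _; rewrite !mxE mulrC.
Qed.

Lemma cols_residual (R : realType) n s (B : 'M[R]_n) (u w : 'I_s -> 'cV[R]_n) :
  mx_of_cols u - B *m mx_of_cols w = mx_of_cols (fun k => u k - B *m w k).
Proof.
apply/matrixP => i k; rewrite !mxE; congr (_ - _).
by apply: eq_bigr => l _; rewrite mxE.
Qed.

(** Bounding column by column loses a factor [sqrt s] against the norm of
    [z], because the 1-norm of [z] comes in. *)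
Lemma norm2_mulmx_cols_le (R : realType) n s (v : 'I_s -> 'cV[R]_n)
    (z : 'cV[R]_s) (d : R) :
  0 <= d -> (forall k, norm2 (v k) <= d) ->
  norm2 (mx_of_cols v *m z) <= d * (Num.sqrt s%:R * norm2 z).
Proof.
move=> d_ge0 v_le; rewrite mulmx_cols; apply: le_trans (ler_norm2_sum _) _.
apply: le_trans (ler_wpM2l d_ge0 (sum_norm_le_norm2 z)).
rewrite mulr_sumr; apply: ler_sum => k _.
by rewrite norm2Z mulrC ler_wpM2r.
Qed.

(** The correction [W z] is built so that [V^T (y - W z) = z]; the update
    [U V^T] therefore contributes [U z], which pairs with [B W z]. *)
Lemma residual_low_rank_update (R : comUnitRingType) n s (B : 'M[R]_n)
    (U W : 'M[R]_(n, s)) (Vt : 'M[R]_(s, n)) (b y : 'cV[R]_n) :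
  1%:M + Vt *m W \in unitmx ->
  let z := invmx (1%:M + Vt *m W) *m (Vt *m y) in
  b - (B + U *m Vt) *m (y - W *m z) = (b - B *m y) - (U - B *m W) *m z.
Proof.
move=> M_unit z.
have Vx : Vt *m (y - W *m z) = z.
  have := mulKVmx M_unit (Vt *m y); rewrite -/z mulmxDl mul1mx -mulmxA.
  by rewrite mulmxBr => <-; rewrite addrK.
rewrite mulmxDl -[U *m Vt *m _]mulmxA Vx mulmxBr mulmxBl mulmxA.
by rewrite !opprD !opprK !addrA addrAC.
Qed.

Theorem theorem4p3 (R : realType) (n s : nat)
    (A Atilde : 'M[R]_n) (b : 'cV[R]_n)
    (u : 'I_s -> 'cV[R]_n) (j : 'I_s -> 'I_n)
    (eps : R) (yhat : 'cV[R]_n) (what : 'I_s -> 'cV[R]_n) :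
  let U := mx_of_cols u in
  let V := mx_of_cols (fun k => col (j k) (1%:M : 'M[R]_n)) in
  let What := mx_of_cols what in
  let r_yhat := b - Atilde *m yhat in
  let r_what := fun k : 'I_s => u k - Atilde *m what k in
  let z := invmx (1%:M + V^T *m What) *m (V^T *m yhat) in
  let c := norm2 z in
  let xhat := yhat - What *m z in
  let r := b - A *m xhat in
  A \in unitmx ->
  b != 0 ->
  Atilde \in unitmx ->
  (forall k : 'I_s, u k != 0) ->
  injective j ->
  A = Atilde + U *m V^T ->
  0 < eps ->
  1%:M + V^T *m What \in unitmx ->
  c != 0 ->
  norm2 r_yhat / norm2 b < eps / 2 ->
  (forall k : 'I_s,
     norm2 (r_what k) / norm2 (u k)
       < norm2 b / (2 * Num.sqrt (s%:R : R) * c * norm2 (u k)) * eps) ->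
  norm2 r / norm2 b < eps.
Proof.
move=> U V What r_yhat r_what z c xhat r _ b_neq0 _ u_neq0 _ defA eps_gt0.
move=> M_unit c_neq0 ry_lt rw_lt.
have b_gt0 := norm2_gt0 b_neq0.
have c_gt0 : 0 < c by rewrite lt0r c_neq0 norm2_ge0.
(* For [s = 0] the vector [z] would be empty and [c] would vanish. *)
have s_gt0 : 0 < Num.sqrt (s%:R : R).
  rewrite sqrtr_gt0 ltr0n lt0n; apply: contra c_neq0 => /eqP s0.
  rewrite /c /norm2 big1 ?sqrtr0 // => i _.
  by have := ltn_ord i; rewrite [X in (_ < X)%N]s0.
set q := Num.sqrt (s%:R : R) in s_gt0 rw_lt.
pose d := norm2 b * eps / (2 * (q * c)).
have d_ge0 : 0 <= d by rewrite divr_ge0 ?mulr_ge0 ?ltW.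
have rw_le k : norm2 (r_what k) <= d.
  have u_gt0 := norm2_gt0 (u_neq0 k).
  have := rw_lt k; rewrite ltr_pdivrMr // => /ltW.
  suff -> : norm2 b / (2 * q * c * norm2 (u k)) * eps * norm2 (u k) = d by [].
  by rewrite /d; field; rewrite !gt_eqF.
have r_split : r = r_yhat - mx_of_cols r_what *m z.
  rewrite /r defA residual_low_rank_update // /U /What cols_residual.
  by [].
have Rz_le : norm2 (mx_of_cols r_what *m z) <= eps / 2 * norm2 b.
  apply: le_trans (norm2_mulmx_cols_le z d_ge0 rw_le) _.
  suff -> : d * (q * c) = eps / 2 * norm2 b by [].
  by rewrite /d; field; rewrite !gt_eqF.
rewrite ltr_pdivrMr //; move: ry_lt; rewrite ltr_pdivrMr // => ry_lt.
rewrite r_split; apply: le_lt_trans (ler_norm2D _ _) _; rewrite norm2N.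
lra.
Qed.
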